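(* For the first-to-complete scheme using alignment sets of sizes $2$ and $4$, with all channel realizations in the finite set $\mathcal H$ equally likely, the average decoding delay is $$d^{(2,4)}=\tfrac34\,|\mathcal H|=\tfrac34\, d^{(2)},$$ where $d^{(2)}$ is the average delay of interference alignment using only complementary channel realizations.
   Context: $\mathcal H$ is a finite set of complex $K\times K$ matrices (quantized channel realizations $\mathbf H=[h_{kl}]$). At each time step a channel realization $\mathbf H(t)\in\mathcal H$ occurs, uniformly distributed on $\mathcal H$ and independent over time. The complement $\mathbf H^c$ of $\mathbf H$ has entries $h_{kk}$ on the diagonal and $-h_{kl}$ for $k\ne l$. An alignment set of size $m$ ($m$ a positive even integer) is a collection of $m$ matrices $\mathbf H^{(0)},\ldots,\mathbf H^{(m-1)}$ such that $h^{(0)}_{kk}=\cdots=h^{(m-1)}_{kk}$ for all $k$, and for all $k\ne l$: $|h^{(0)}_{kl}|=\cdots=|h^{(m-1)}_{kl}|$, exactly $\frac m2-1$ of the indices $i\in\{1,\ldots,m-1\}$ satisfy $h^{(i)}_{kl}=h^{(0)}_{kl}$, and exactly $\frac m2$ satisfy $h^{(i)}_{kl}=-h^{(0)}_{kl}$. Thus $\{\mathbf H,\mathbf H^c\}$ is an alignment set of size $2$. $\mathcal A_{\mathbf H}$ denotes an alignment set of size $4$ having $\mathbf H$ as a member; its four members are distinct elements of $\mathcal H$, and it does not contain $\mathbf H^c\in\mathcal H$. Alignment using complements: a symbol first sent at time $t_0$, when the realization is $\mathbf H$, is recovered at the first time $t>t_0$ at which $\mathbf H^c$ occurs. First-to-complete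 scheme: a symbol first sent at time $t_0$, when the realization is $\mathbf H$, is recovered at the first time $t>t_0$ by which either $\mathbf H^c$ has occurred or all three other members of $\mathcal A_{\mathbf H}$ have occurred (occurrences being counted at times after $t_0$). The average delay of a scheme is the expected number of time steps between the first time a symbol is sent and the time it is recovered at the receiver (recovery at time $t_1$ gives delay $t_1-t_0$). *)

(* Defs.v *)
From HB Require Import structures.
From mathcomp Require Import all_boot all_order all_algebra finmap complex.
From mathcomp Require Import all_classical all_reals all_analysis.

Set Implicit Arguments.
Unset Strict Implicit.
Unset Printing Implicit Defensive.

Import Order.TTheory GRing.Theory Num.Theory.
Local Open Scope classical_set_scope.
Local Open Scope ring_scope.

Section Channels.
Variables (R : realType) (K : nat).
Implicit Types H : 'M[R[i]]_K.

Definition compl_channel H : 'M[R[i]]_K :=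
  \matrix_(k, l) (if k == l then H k l else - H k l).

(* [S`_0] is the reference matrix H^(0); the default value of [nth] is never
   reached since [0 < m]. *)
Definition alignment_set (m : nat) (S : m.-tuple 'M[R[i]]_K) : Prop :=
  [/\ (0 < m)%N,
      ~~ odd m,
      (forall (i : 'I_m) (k : 'I_K), tnth S i k k = S`_0 k k)
    & forall k l : 'I_K, k != l ->
      [/\ forall i : 'I_m, `|tnth S i k l| = `|S`_0 k l|,
          #|[pred i : 'I_m | (0 < i)%N && (tnth S i k l == S`_0 k l)]|
            = (m./2 - 1)%N
        & #|[pred i : 'I_m | (0 < i)%N && (tnth S i k l == - S`_0 k l)]|
            = m./2]].

End Channels.

Section Process.
Context {d : measure_display} {Omega : measurableType d} {R : realType}.
Variables (P : probability Omega R) (M : choiceType).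
Implicit Types X : nat -> Omega -> M.

(* The alphabet [M] carries the full power set as sigma-algebra; the variables
   take finitely many values. *)
Definition mutually_independent X : Prop :=
  forall (J : {fset nat}) (B : nat -> set M),
    P (\bigcap_(t in [set` J]) (X t @^-1` B t))
      = (\prod_(t <- J) P (X t @^-1` B t))%E.

Definition iid_uniform (HH : {fset M}) X : Prop :=
  [/\ forall t w, X t w \in HH,
      forall t (B : set M), measurable (X t @^-1` B),
      forall t H, H \in HH -> P (X t @^-1` [set H]) = (#|` HH|%:R^-1)%:E
    & mutually_independent X].

(* [occurs_in x t0 t H]: the realization [H] occurs at some time in ]t0, t]. *)
Definition occurs_in (x : nat -> M) (t0 t : nat) (H : M) : Prop :=
  exists2 s, (t0 < s <= t)%N & x s = H.

(* Time from [t0] to the first later time satisfying [rec]; it is +oo when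
   there is no such time. *)
Definition delay (t0 : nat) (rec : set nat) : \bar R :=
  ereal_inf [set (t - t0)%N%:R%:E | t in [set t | (t0 < t)%N /\ rec t]].

(* [rec x t0 t]: along the trajectory [x], a symbol first sent at [t0] can be
   recovered at time [t]. *)
Definition average_delay (rec : (nat -> M) -> nat -> set nat) X (t0 : nat) :
    \bar R :=
  (\int[P]_w delay t0 (rec (fun t => X t w) t0))%E.

End Process.

Section Schemes.
Variables (R : realType) (K : nat).
Implicit Types x : nat -> 'M[R[i]]_K.

Definition complement_rec x (t0 t : nat) : Prop :=
  x t = compl_channel (x t0).

Definition first_to_complete_rec (A : 'M[R[i]]_K -> 4.-tuple 'M[R[i]]_K)
    x (t0 t : nat) : Prop :=
  occurs_in x t0 t (compl_channel (x t0)) \/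
  (forall H, H \in A (x t0) -> H != x t0 -> occurs_in x t0 t H).

End Schemes.

(* Main.v *)
(** A delay is the sum over [n] of the indicators of "not yet recovered at time
    [t0 + n]", so its mean is the sum of the probabilities of these events.
    Let N be the size of the alphabet, [c] the complement of the realization at
    [t0] and [a0, a1, a2] the other members of its alignment set. Not being
    recovered means that, for some [i], the window ]t0, t0 + n] misses both [c]
    and [ai]. A given set of [k] realizations is missed with probability
    (1 - k/N)^n, so inclusion-exclusion over [i] gives
    3 (1 - 2/N)^n - 3 (1 - 3/N)^n + (1 - 4/N)^n, and summing the geometric
    series gives N (3/2 - 3/3 + 1/4) = 3N/4. *)

Require Import Defs.
From HB Require Import structures.
From mathcomp Require Import all_boot all_order all_algebra finmap complex.
From mathcomp Require Import all_classical all_reals all_analysis.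
From mathcomp Require Import measurable_realfun ring lra.

Import Order.TTheory GRing.Theory Num.Theory.
Import numFieldNormedType.Exports.
Local Open Scope classical_set_scope.
Local Open Scope ring_scope.

(** * Delays as sums of tail indicators *)

Definition unrecovered (t0 n : nat) (rec : set nat) : Prop :=
  forall t, (t0 < t <= t0 + n)%N -> ~ rec t.

(** Term [n] says that the delay exceeds [n]; term 0 is always 1, since its window is empty. With
    [m] the first recovery time, exactly the terms [n < m - t0] equal 1; without recovery every term
    is 1 and both sides are infinite. *)
Lemma delay_tail_sum (R : realType) (t0 : nat) (rec : set nat) :
  delay t0 rec =
    (\sum_(0 <= n <oo) (`[< unrecovered t0 n rec >]%:R)%:E)%E :> \bar R.
Proof.
have [[t Ht]|no_rec] := pselect (exists t, (t0 < t)%N /\ rec t).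
  have: exists t, `[< (t0 < t)%N /\ rec t >] by exists t; apply/asboolP.
  case/ex_minnP => m /asboolP[t0_lt_m rec_m] m_min.
  have -> : delay t0 rec = (m - t0)%N%:R%:E :> \bar R.
    apply/eqP; rewrite eq_le; apply/andP; split.
      by apply: ereal_inf_lbound; exists m.
    apply: le_ereal_inf_tmp => _ [s rec_s <-].
    by rewrite lee_fin ler_nat leq_sub2r// m_min//; apply/asboolP.
  have unrecE n : `[< unrecovered t0 n rec >] = (n < m - t0)%N.
    apply/asboolP/idP => [unrec|n_lt s /andP[t0_lt_s s_le] rec_s].
      rewrite ltn_subRL ltnNge; apply/negP => m_le.
      by apply: (unrec m) => //; rewrite t0_lt_m.
    have /m_min : `[< (t0 < s)%N /\ rec s >] by apply/asboolP.
    by apply/negP; rewrite -ltnNge (leq_ltn_trans s_le)// -ltn_subRL.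
  apply/esym/cvg_lim => //; apply: cvg_near_cst.
  exists (m - t0)%N => //= n /= le_n.
  rewrite sumEFin -natr_sum (big_cat_nat (n := (m - t0)%N))//=.
  rewrite (eq_big_nat _ _ (F2 := fun=> 1%N)); last first.
    by move=> i /andP[_ i_lt]; rewrite unrecE i_lt.
  rewrite [X in (_ + X)%N]big_nat_cond [X in (_ + X)%N]big1; last first.
    by move=> i /andP[/andP[i_ge _] _]; rewrite unrecE ltnNge i_ge.
  by rewrite sum_nat_const_nat muln1 addn0 subn0.
have -> : delay t0 rec = +oo%E :> \bar R.
  rewrite /delay (_ : [set t | _] = set0) ?image_set0 ?ereal_inf0//.
  by apply/seteqP; split => // t Ht; apply: no_rec; exists t.
apply/esym/cvg_lim => //.
rewrite (_ : (fun n => _) = (fun n : nat => n%:R%:E)); first exact/cvgenyP.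
apply/funext => n; rewrite sumEFin -natr_sum; congr (_%:R%:E).
rewrite (eq_bigr (fun=> 1%N)) ?sum_nat_const_nat ?muln1 ?subn0// => i _.
by rewrite asboolT// => t /andP[t0_lt_t _] rec_t; apply: no_rec; exists t.
Qed.

(** * Geometric series and their transfer to the extended reals *)

Lemma eseries_EFin {R : realType} (u : nat -> R) (l : R) :
  (fun n => \sum_(0 <= i < n) u i) @ \oo --> l ->
  (\sum_(0 <= n <oo) (u n)%:E)%E = l%:E.
Proof.
move=> u_l; apply/cvg_lim => //.
under eq_fun do rewrite sumEFin.
by apply: cvg_EFin => //; apply: nearW.
Qed.

Lemma cvg_sum_expr {R : realType} (q : R) : `|q| < 1 ->
  (fun n => \sum_(0 <= i < n) q ^+ i) @ \oo --> (1 - q)^-1.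
Proof.
move=> /(cvg_geometric_series (a := 1)); rewrite div1r; apply: cvg_trans.
apply: near_eq_cvg; apply: nearW => n /=.
by apply: eq_bigr => i _; rewrite /= mul1r.
Qed.

(** An empty space would have total mass 0. A sample point supplies a realization, hence lower
    bounds on the size of the alphabet. *)
Lemma probability_inhabited {d : measure_display} {T : measurableType d}
    {R : realType} (P : probability T R) : exists w : T, True.
Proof.
apply: contrapT => noT; have := probability_setT P.
rewrite (_ : setT = set0) ?measure0 => [/eqP|].
  by rewrite eqe eq_sym oner_eq0.
by apply/seteqP; split => // w _; case: noT; exists w.
Qed.

(** * Probabilities of avoiding given realizations *)

Section AvoidanceEvents.
Context {d : measure_display} {Omega : measurableType d} {R : realType}.
Context {P : probability Omega R} {M : choiceType}.
Implicit Types X : nat -> Omega -> M.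

(** Nonnegative measurable terms allow the integral and the series of indicators to be exchanged. *)
Lemma average_delay_tail_sum (rec : (nat -> M) -> nat -> set nat) X (t0 : nat) :
  let E n := [set w | unrecovered t0 n (rec (X^~ w) t0)] in
  (forall n, measurable (E n)) ->
  average_delay P rec X t0 = (\sum_(0 <= n <oo) P (E n))%E.
Proof.
move=> E mE; rewrite /average_delay.
have indicE n w :
    `[< unrecovered t0 n (rec (X^~ w) t0) >]%:R = \1_(E n) w :> R.
  by rewrite indicE; congr (_%:R); apply/asboolP/idP; rewrite inE.
under eq_integral do
  (rewrite delay_tail_sum; under eq_eseriesr do rewrite indicE).
rewrite integral_nneseries//; last first.
  by move=> n; apply/measurable_EFinP/measurable_indic.
by apply: eq_eseriesr => n _; rewrite integral_indic// setIT.
Qed.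

Lemma prob_mem_seq {HH : {fset M}} {X} (X_iid : iid_uniform P HH X)
    t (s : seq M) :
  uniq s -> {subset s <= HH} ->
  P (X t @^-1` [set` s]) = ((size s)%:R / #|` HH|%:R)%:E.
Proof.
case: X_iid => X_HH mX PX _.
elim: s => [_ _|x s IHs /= /andP[xs us] sub].
  by rewrite mul0r (_ : _ @^-1` _ = set0) ?measure0//; apply/seteqP; split.
have -> : X t @^-1` [set` x :: s] = X t @^-1` [set x] `|` X t @^-1` [set` s].
  apply/seteqP; split => w /=; rewrite inE.
    by case/predU1P => ?; [left|right].
  by case=> [->|->]; rewrite ?eqxx ?orbT.
apply: etrans (measureU P (mX _ _) (mX _ _) _) _.
  apply/seteqP; split => // w /= [-> xs'].
  by rewrite xs' in xs.
rewrite [X in (_ + X)%E]IHs//; last by move=> y ys; rewrite sub// inE ys orbT.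
rewrite [X in (X + _)%E]PX; last by rewrite sub// mem_head.
by rewrite -EFinD -natr1 mulrDl mul1r addrC.
Qed.

(** The forbidden list is a function [S] of the realization at [t0], because the complement and the
    alignment set vary with it. *)
Definition avoids X (t0 n : nat) (S : M -> seq M) : set Omega :=
  [set w | forall t, (t0 < t <= t0 + n)%N -> X t w \notin S (X t0 w)].

Lemma avoidsI X t0 n (S T : M -> seq M) :
  avoids X t0 n S `&` avoids X t0 n T = avoids X t0 n (fun H => S H ++ T H).
Proof.
apply/seteqP; split => w /=.
  by case=> aS aT t t_in; rewrite mem_cat negb_or aS ?aT.
move=> aST; split=> t t_in; have := aST t t_in; rewrite mem_cat negb_or;
  by case/andP.
Qed.

(** Fixing the value [H] at [t0] freezes the forbidden list, so the event splits into finitely many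
    cylinders, the form to which independence applies. *)
Lemma avoidsE {HH : {fset M}} {X} (X_iid : iid_uniform P HH X)
    t0 n (S : M -> seq M) :
  let B H t := if t == t0 then [set H] else ~` [set` S H] in
  avoids X t0 n S = \bigcup_(H in [set` HH])
    \bigcap_(t in [set` [fset t in iota t0 n.+1]%fset]) X t @^-1` B H t.
Proof.
case: X_iid => X_HH _ _ _ B.
have inJ t : (t \in [fset t in iota t0 n.+1]%fset) = (t0 <= t <= t0 + n)%N.
  by rewrite in_fset mem_iota addnS ltnS.
apply/seteqP; split => w.
  move=> aS; exists (X t0 w) => /=; first exact: X_HH.
  move=> t /=; rewrite inJ /B; case: eqVneq => [->//|t_neq] t_in.
  by apply/negP; rewrite aS// ltn_neqAle eq_sym t_neq.
case=> H /= H_HH cap t t_in.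
have Xt0 : X t0 w = H.
  by have := cap t0; rewrite /= inJ leqnn leq_addr /B eqxx; exact.
rewrite Xt0; have := cap t; rewrite /= inJ /B.
case/andP: t_in => t0_lt ->; rewrite (ltnW t0_lt) gtn_eqF// => /(_ isT) /=.
by move/negP.
Qed.

Lemma measurable_avoids {HH : {fset M}} {X} (X_iid : iid_uniform P HH X)
    t0 n (S : M -> seq M) :
  measurable (avoids X t0 n S).
Proof.
rewrite (avoidsE X_iid); case: X_iid => _ mX _ _.
apply: fin_bigcup_measurable => // H _.
by apply: fin_bigcap_measurable => // t _; exact: mX.
Qed.

(** Each value [H] at [t0] contributes [1/N] times [n] independent factors [1 - k/N], and the [N]
    equal contributions add up. Only distinct forbidden realizations count, hence [undup]. *)
Lemma prob_avoids {HH : {fset M}} {X} (X_iid : iid_uniform P HH X)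
    t0 n (S : M -> seq M) k :
  (forall H, H \in HH ->
    size (undup (S H)) = k /\ {subset S H <= HH}) ->
  P (avoids X t0 n S) = ((1 - k%:R / #|` HH|%:R) ^+ n)%:E.
Proof.
move=> HS; rewrite (avoidsE X_iid); have [X_HH mX PX indep] := X_iid.
have HH_gt0 : (0 < #|` HH|)%N.
  have [w _] := probability_inhabited P.
  by rewrite cardfs_gt0; apply/fset0Pn; exists (X 0 w).
rewrite measure_fin_bigcup//; last 2 first.
(* The cylinders are disjoint: each one fixes the value at [t0]. *)
- move=> H H' _ _ [w [cap cap']].
  have t0J : [set` [fset t in iota t0 n.+1]%fset] t0.
    by rewrite /= in_fset mem_head.
  by have := cap _ t0J; have := cap' _ t0J; rewrite /= eqxx => <- <-.
- by move=> H _; apply: fin_bigcap_measurable => // t _; exact: mX.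
rewrite -fsbig_seq ?fset_uniq//.
rewrite (eq_big_seq
  (fun=> (#|` HH|%:R^-1 * (1 - k%:R / #|` HH|%:R) ^+ n)%:E)).
  rewrite sumEFin big_const_seq count_predT iter_addr_0.
  by congr _%:E; rewrite -[LHS]mulr_natl mulrA divff ?mul1r// pnatr_eq0 -lt0n.
move=> H H_HH; apply: etrans (indep _ _) _.
rewrite (perm_big (iota t0 n.+1)); last first.
  by apply: uniq_perm => [||t]; rewrite ?fset_uniq ?iota_uniq ?in_fset.
(* The head of the list is [t0], with factor [1/N]; the [n] later times remain. *)
rewrite big_cons eqxx PX//.
rewrite (eq_big_seq (fun=> (1 - k%:R / #|` HH|%:R)%:E)).
  rewrite prodEFin; congr (_ * _)%:E.
  by rewrite big_const_seq count_predT size_iota iter_mulr_1.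
move=> t; rewrite mem_iota => /andP[t0_lt _]; rewrite gtn_eqF//.
have [<- sS] := HS H H_HH.
rewrite (_ : [set` S H] = [set` undup (S H)]); last first.
  by apply/seteqP; split => G /=; rewrite mem_undup.
apply: etrans (probability_setC P (mX t [set` undup (S H)])) _.
rewrite (prob_mem_seq X_iid) ?undup_uniq// => G.
by rewrite mem_undup; exact: sS.
Qed.

End AvoidanceEvents.

(** Inclusion-exclusion for two events, applied three times. Real values for all the intersections
    reduce the final identity to ring arithmetic in [R]. *)
Lemma probabilityU3 {d : measure_display} {T : measurableType d} {R : realType}
    (P : probability T R) {A B C : set T} {a b c ab ac bc abc : R} :
  measurable A -> measurable B -> measurable C ->
  P A = a%:E -> P B = b%:E -> P C = c%:E ->
  P (A `&` B) = ab%:E -> P (A `&` C) = ac%:E -> P (B `&` C) = bc%:E ->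
  P (A `&` B `&` C) = abc%:E ->
  P (A `|` B `|` C) = (a + b + c - ab - ac - bc + abc)%:E.
Proof.
move=> mA mB mC PA PB PC PAB PAC PBC PABC.
have PU D E : measurable D -> measurable E ->
    P (D `|` E) = (P D + P E - P (D `&` E))%E.
  move=> mD mE; apply: measureUfinl => //.
  exact: le_lt_trans (probability_le1 P mD) (ltry _).
rewrite PU//; last exact: measurableU.
rewrite PU// setIUl PU; [|exact: measurableI|exact: measurableI].
have -> : A `&` C `&` (B `&` C) = A `&` B `&` C by rewrite setIACA setIid.
rewrite PA PB PC PAB PAC PBC PABC -!EFinD.
by congr (_%:E); ring.
Qed.

(** * The two schemes in terms of avoidance *)

Lemma compl_recE {R : realType} {K : nat} (x : nat -> 'M[R[i]]_K) t0 n :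
  unrecovered t0 n (complement_rec x t0) <->
  forall t, (t0 < t <= t0 + n)%N -> x t \notin [:: compl_channel (x t0)].
Proof.
by split=> unrec t /unrec; rewrite /complement_rec inE => /eqP.
Qed.

(** Occurrences accumulate, so a member still missing at the end of the window is missing throughout
    it; a single [H] therefore serves for all [t]. *)
Lemma first_to_complete_unrecE {R : realType} {K : nat}
    (A : 'M[R[i]]_K -> 4.-tuple 'M[R[i]]_K) (x : nat -> 'M[R[i]]_K) t0 n
    (H1 H2 H3 : 'M[R[i]]_K) :
  [seq H <- A (x t0) | H != x t0] = [:: H1; H2; H3] ->
  unrecovered t0 n (first_to_complete_rec A x t0) <->
  exists2 H, H \in [:: H1; H2; H3] &
    forall t, (t0 < t <= t0 + n)%N -> x t \notin [:: compl_channel (x t0); H].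
Proof.
move=> AE.
have memA H : (H \in [:: H1; H2; H3]) = (H != x t0) && (H \in A (x t0)).
  by rewrite -AE mem_filter.
split=> [unrec|[H]].
  (* For [n = 0] the window has no last time to inspect, and any member is a witness. *)
  case: n unrec => [_|n unrec].
    by exists H1; rewrite ?mem_head// => t; rewrite addn0 ltnNge andNb.
  have last_in : (t0 < t0 + n.+1 <= t0 + n.+1)%N.
    by rewrite leqnn addnS ltnS leq_addr.
  have := unrec _ last_in; rewrite /first_to_complete_rec => /not_orP[no_c].
  move=> /existsNP[H] /not_implyP[HA] /not_implyP[Hx no_H].
  exists H; first by rewrite memA Hx HA.
  move=> t t_in; rewrite !inE negb_or; apply/andP; split; apply/eqP => xt.
    by apply: no_c; exists t.
  by apply: no_H; exists t.
rewrite memA => /andP[Hx HA] avoid t /andP[_ t_le].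
case=> [[s /andP[t0_lt_s s_le] xs]|all_occ].
  have := avoid s; rewrite t0_lt_s (leq_trans s_le t_le) => /(_ isT).
  by rewrite xs mem_head.
have [s /andP[t0_lt_s s_le] xs] := all_occ H HA Hx.
have := avoid s; rewrite t0_lt_s (leq_trans s_le t_le) => /(_ isT).
by rewrite xs !inE eqxx orbT.
Qed.

(** * Average delays of the two schemes *)

Theorem lemma4 (R : realType) (d : measure_display) (Omega : measurableType d)
  (P : probability Omega R) (K : nat) (HH : {fset 'M[R[i]]_K})
  (X : nat -> Omega -> 'M[R[i]]_K)
  (X_iid : iid_uniform P HH X)
  (HH_compl : forall H, H \in HH -> compl_channel H \in HH)
  (A : 'M[R[i]]_K -> 4.-tuple 'M[R[i]]_K)
  (A_align : forall H, H \in HH -> alignment_set (A H))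
  (A_mem : forall H, H \in HH -> H \in A H)
  (A_uniq : forall H, H \in HH -> uniq (A H))
  (A_sub : forall H, H \in HH -> {subset A H <= HH})
  (A_compl : forall H, H \in HH -> compl_channel H \notin A H)
  (t0 : nat) :
  average_delay P (first_to_complete_rec A) X t0
    = (3 / 4 * #|` HH|%:R)%:E /\
  (3 / 4 * #|` HH|%:R)%:E
    = ((3 / 4)%:E * average_delay P (@complement_rec R K) X t0)%E.
Proof.
have memX t w : X t w \in HH by case: X_iid.
set c := @compl_channel R K.
(* For [H] in [HH] and [i < 3] the default is never reached: removing [H] from four distinct members
   leaves exactly three. *)
pose other i H := nth H [seq G <- A H | G != H] i.
have others H : H \in HH ->
    [seq G <- A H | G != H] = [:: other 0 H; other 1 H; other 2 H].
  move=> HHH; have : size [seq G <- A H | G != H] = 3%N.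
    have := count_predC (pred1 H) (A H).
    by rewrite count_uniq_mem ?A_uniq// A_mem// size_tuple size_filter => -[].
  by rewrite /other; case: [seq G <- A H | G != H] => [|? [|? [|? []]]].
have uniq_others H : H \in HH ->
    uniq [:: c H; other 0 H; other 1 H; other 2 H] /\
    {subset [:: c H; other 0 H; other 1 H; other 2 H] <= HH}.
  move=> HHH; have cA := A_compl H HHH.
  rewrite -others// cons_uniq mem_filter (negbTE cA) andbF
    filter_uniq ?A_uniq//.
  split=> // G; rewrite !inE mem_filter => /predU1P[->|/andP[_ GA]].
    exact: HH_compl.
  exact: A_sub GA.
have hit (n : nat) S k :
    (forall H, H \in HH -> size (undup (S H)) = k /\
       {subset S H <= [:: c H; other 0 H; other 1 H; other 2 H]}) ->
    P (avoids X t0 n S) = ((1 - k%:R / #|` HH|%:R) ^+ n)%:E.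
  move=> HS; apply: (prob_avoids X_iid) => H HHH.
  have [? sub] := HS H HHH; split=> // G /sub.
  by have [_] := uniq_others H HHH; exact.
(* The complement and the three other members are four distinct elements of [HH]. This keeps the
   ratios [1 - k/N] in [[0, 1)] for [k] from 1 to 4. *)
have N4 : (4 <= #|` HH|)%N.
  have [w _] := probability_inhabited P.
  have [u s] := uniq_others _ (memX 0 w).
  exact: uniq_leq_size u s.
pose N : R := #|` HH|%:R.
have N_ge4 : 4 <= N by rewrite /N ler_nat.
pose q k : R := 1 - k%:R / N.
have q_lt1 k : (0 < k <= 4)%N -> `|q k| < 1.
  move=> /andP[k0 k4].
  have k0' : 0 < k%:R :> R by rewrite ltr0n.
  have k4' : k%:R <= 4 :> R by rewrite ler_nat.
  have N0 : 0 < N by lra.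
  rewrite /q ger0_norm; last by rewrite subr_ge0 ler_pdivrMr//; lra.
  by rewrite gtrBl divr_gt0.
have sum_q k : (0 < k <= 4)%N ->
    (fun n => \sum_(0 <= i < n) q k ^+ i) @ \oo --> N / k%:R.
  have <- : (1 - q k)^-1 = N / k%:R by rewrite /q opprB addrC subrK invf_div.
  by move=> /q_lt1/cvg_sum_expr.
have delay2 : average_delay P (@complement_rec R K) X t0 = N%:E.
  have unrecE n : [set w | unrecovered t0 n (complement_rec (X^~ w) t0)] =
      avoids X t0 n (fun H => [:: c H]).
    by apply/seteqP; split=> w /compl_recE.
  rewrite average_delay_tail_sum; last first.
    by move=> n; rewrite unrecE; exact: measurable_avoids X_iid _ _ _.
  under eq_eseriesr => n _.
    rewrite unrecE (hit _ _ 1%N); last first.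
      by move=> H HHH; split => // G; rewrite !inE => ->.
    over.
  by apply: eseries_EFin; rewrite -[N]divr1; exact: sum_q.
have delay24 : average_delay P (first_to_complete_rec A) X t0 = (3 / 4 * N)%:E.
  pose S i H := [:: c H; other i H].
  have unrecE n :
      [set w | unrecovered t0 n (first_to_complete_rec A (X^~ w) t0)] =
      avoids X t0 n (S 0) `|` avoids X t0 n (S 1) `|` avoids X t0 n (S 2).
    apply/seteqP; split=> w.
      move=> /(first_to_complete_unrecE _ _ _ _ _ _ _ (others _ (memX _ _))).
      case=> G; rewrite !inE => /or3P[] /eqP-> avoid.
      - by left; left.
      - by left; right.
      - by right.
    move=> avoid.
    apply/(first_to_complete_unrecE _ _ _ _ _ _ _ (others _ (memX _ _))).
    case: avoid => [[]|] avoid.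
    - by exists (other 0 (X t0 w)); rewrite ?inE ?eqxx.
    - by exists (other 1 (X t0 w)); rewrite ?inE ?eqxx ?orbT.
    - by exists (other 2 (X t0 w)); rewrite ?inE ?eqxx ?orbT.
  have mav n T : measurable (avoids X t0 n T).
    exact: measurable_avoids X_iid _ _ _.
  rewrite average_delay_tail_sum; last first.
    by move=> n; rewrite unrecE; do !apply: measurableU.
  (* Single events forbid 2 realizations. Intersections concatenate lists that share [c H], leaving
     3 distinct entries for a pair and 4 for the triple. *)
  have hits n :
      P (avoids X t0 n (S 0) `|` avoids X t0 n (S 1) `|` avoids X t0 n (S 2)) =
      (q 2 ^+ n + q 2 ^+ n + q 2 ^+ n - q 3 ^+ n - q 3 ^+ n - q 3 ^+ n
        + q 4 ^+ n)%:E.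
    apply: probabilityU3 => //; rewrite ?avoidsI; apply: hit => H HHH;
      have [/= /and4P[+ + + _] _] := uniq_others H HHH;
      rewrite !inE ?negb_or; move=> /and3P[n0 n1 n2] /andP[n01 n02] n12;
      rewrite /S /= ?[other 0 H == c H]eq_sym ?[other 1 H == c H]eq_sym ?eqxx
        ?(negbTE n0) ?(negbTE n1) ?(negbTE n2) ?(negbTE n01) ?(negbTE n02)
        ?(negbTE n12) /= ?orbT;
      split=> // G; rewrite !inE; do ?case/orP; move=> /eqP->;
      by rewrite eqxx ?orbT.
  under eq_eseriesr do rewrite unrecE hits.
  (* The target is split to match the seven geometric series term by term. *)
  have -> : 3 / 4 * N = N / 2 + N / 2 + N / 2 - N / 3 - N / 3 - N / 3 + N / 4.
    by field.
  apply: eseries_EFin; under eq_fun do rewrite !big_split /= !sumrN.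
  by do ![apply: cvgB | apply: cvgD | exact: sum_q].
by rewrite delay2 -EFinM.
Qed.
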